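(* Let $n\ge0$ be an integer, $\beta$ a complex number, and $G_n^\beta=U_nE^{n\beta}U_n^{-1}$ acting on the space $\mathcal P_n$ of complex polynomials of degree at most $n$. Then for every $p=0,1,\dots,n$, $$G_n^\beta x^p=\sum_{m=0}^{n}\binom{-n\beta+p}{m}\binom{n\beta+n-p}{n-m}x^m .$$
   Context: The Euler polynomials $A_k(x)$ are defined by $\frac{A_k(x)}{(1-x)^{k+1}}=\sum_{m\ge0}m^kx^m$, with $A_0=1$. $U_n$ is the linear operator on $\mathcal P_n$ with $U_n x^p=\frac1{n!}(1-x)^{n-p}A_p(x)$, $p=0,\dots,n$ (invertible, with $U_n^{-1}x^p=(x)_p[x+1]_{n-p}$, where $(\varphi)_k$, $[\varphi]_k$ are falling and rising factorials). $E^{c}f(x)=f(x+c)$. $\binom{c}{k}=c(c-1)\cdots(c-k+1)/k!$ for complex $c$. *)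

(* Defs.v *)
From HB Require Import structures.
From mathcomp Require Import all_boot all_order all_algebra.
From mathcomp Require Export all_reals complex.

Set Implicit Arguments.
Unset Strict Implicit.
Unset Printing Implicit Defensive.

Import Order.TTheory GRing.Theory Num.Theory.
Local Open Scope ring_scope.

Section BackwardDifference.
Variable F : numFieldType.
Implicit Types (f : nat -> F) (q : {poly F}).

(* The effect of multiplication by [1 - x] on the coefficients of a formal
   power series. *)
Definition bdiff f (j : nat) : F := if j is i.+1 then f i.+1 - f i else f 0%N.

Lemma take_poly_bdiff N s f :
  take_poly N ((1 - 'X) ^+ s * \poly_(m < N) f m) =
  \poly_(j < N) iter s bdiff f j.
Proof.
elim: s f => [|s IHs] f.
  by rewrite expr0 mul1r take_poly_id // size_poly.
have -> : take_poly N ((1 - 'X) ^+ s.+1 * \poly_(m < N) f m) =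
          take_poly N ((1 - 'X) ^+ s * \poly_(m < N) bdiff f m).
  rewrite exprSr -mulrA.
  have low i : (i < N)%N -> ((1 - 'X) * \poly_(m < N) f m)`_i =
                            (\poly_(m < N) bdiff f m)`_i.
    move=> iN; rewrite mulrBl mul1r coefB coefXM !coef_poly iN.
    by case: i iN => [|i] iN /=; rewrite ?subr0 // (ltnW iN).
  apply/polyP => j; rewrite !coef_take_poly; case: ltnP => // jN.
  rewrite !coefM; apply: eq_bigr => i _; congr (_ * _); apply: low.
  exact: leq_ltn_trans (leq_subr _ _) jN.
by rewrite IHs; apply/polyP => j; rewrite !coef_poly iterSr.
Qed.

Lemma iter_bdiff_horner s q f (a : nat) : (size q <= s)%N ->
  (forall j, (a <= j)%N -> f j = q.[j%:R]) ->
  forall j, (a + s <= j)%N -> iter s bdiff f j = 0.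
Proof.
elim: s q f a => [|s IHs] q f a.
  rewrite size_poly_leq0 => /eqP-> fq j; rewrite addn0 => aj.
  by rewrite /= fq // horner0.
move=> sq fq j aj; rewrite iterSr.
apply: (IHs (q - (q \Po ('X - 1%:P))) _ a.+1); last by rewrite addSnnS.
  apply/leq_sizeP => i; rewrite leq_eqVlt => /orP[/eqP <-|si].
    rewrite coefB; have [q_small|q_big] := leqP (size q) s.
      by rewrite !nth_default ?subr0 // size_comp_poly2 ?size_XsubC.
    have sqE : size q = s.+1 by apply/eqP; rewrite eqn_leq sq.
    have sqc : size (q \Po ('X - 1%:P)) = s.+1.
      by rewrite size_comp_poly2 ?size_XsubC.
    have := @lead_coef_comp _ q ('X - 1%:P).
    rewrite size_XsubC lead_coefXsubC => /(_ isT).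
    by rewrite expr1n mulr1 !lead_coefE sqE sqc /= => ->; rewrite subrr.
  by rewrite coefB !nth_default ?subr0 ?size_comp_poly2 ?size_XsubC //;
     apply: leq_trans sq _.
case=> // i; rewrite ltnS => ai /=; rewrite (fq _ ai) (fq _ (leqW ai)).
by rewrite hornerD hornerN horner_comp !hornerE -natr1 addrK.
Qed.

Lemma iter_bdiff_inj s f : (forall j, iter s bdiff f j = 0) -> forall j, f j = 0.
Proof.
elim: s f => [//|s IHs] f; rewrite iterSr => /IHs f0.
elim=> [|j IHj]; first exact: (f0 0%N).
by have /= := f0 j.+1; rewrite IHj subr0.
Qed.

End BackwardDifference.

Section Operators.
Variable F : numFieldType.

(* The polynomial [(1 - x)^(k+1) * \sum_(m >= 0) m^k x^m], with [0^0 = 1]; its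
   coefficients of degree > k vanish, so only those of degree <= k are computed.
   [euler_polyP] is the defining identity of formal power series. *)
Definition euler_poly (k : nat) : {poly F} :=
  take_poly k.+1 ((1 - 'X) ^+ k.+1 * \poly_(m < k.+1) (m ^ k)%:R).

Lemma size_euler_poly k : (size (euler_poly k) <= k.+1)%N.
Proof. exact: size_take_poly. Qed.

Lemma euler_polyP (k N : nat) :
  take_poly N ((1 - 'X) ^+ k.+1 * \poly_(m < N) (m ^ k)%:R) =
  take_poly N (euler_poly k).
Proof.
rewrite /euler_poly !take_poly_bdiff; apply/polyP => j.
rewrite coef_take_poly !coef_poly; case: ltnP => // _; case: ltnP => // kj.
apply: (@iter_bdiff_horner _ k.+1 'X^k _ 0); rewrite ?size_polyXn //.
by move=> i _; rewrite hornerXn natrX.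
Qed.

Lemma euler_poly0 : euler_poly 0 = 1.
Proof.
apply/polyP => j; rewrite /euler_poly take_poly_bdiff coef_poly coef1.
by case: j.
Qed.

Lemma size_U_image n p : (p <= n)%N ->
  (size (n`!%:R^-1 *: ((1 - 'X) ^+ (n - p) * euler_poly p))%R <= n.+1)%N.
Proof.
move=> pn; apply: leq_trans (size_scale_leq _ _) _.
apply: leq_trans (size_polyMleq _ _) _.
have s1X : (size (1 - 'X : {poly F})%R <= 2)%N.
  by rewrite -opprB size_polyN -polyC1 size_XsubC.
have sX : (size ((1 - 'X : {poly F}) ^+ (n - p))%R <= (n - p).+1)%N.
  apply: leq_trans (size_poly_exp_leq _ _) _; rewrite ltnS.
  by rewrite -[leqRHS]mul1n leq_mul2r -subn1 leq_subLR s1X orbT.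
rewrite -subn1 leq_subLR (leq_trans (leq_add sX (size_euler_poly p))) //.
by rewrite addnS addSn subnK // add1n.
Qed.

(* [{poly_n.+1 F}] is the space of polynomials of degree <= n, and [npolyp n.+1]
   casts into it, discarding degrees > n; in [U_fun] and [E_fun] there are none
   to discard ([polyn_U], [polyn_E]). *)
Definition U_fun n (f : {poly_n.+1 F}) : {poly_n.+1 F} :=
  \sum_(p < n.+1) f`_p *:
    npolyp n.+1 (n`!%:R^-1 *: ((1 - 'X) ^+ (n - p) * euler_poly p)).

Fact U_fun_is_linear n : linear (@U_fun n).
Proof.
move=> a f g; rewrite /U_fun scaler_sumr -big_split; apply: eq_bigr => p _ /=.
by rewrite coefD coefZ scalerDl scalerA.
Qed.

HB.instance Definition _ n := GRing.isLinear.Build F {poly_n.+1 F} {poly_n.+1 F}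
  _ (@U_fun n) (@U_fun_is_linear n).

Definition U n : 'End({poly_n.+1 F}) := linfun (@U_fun n).

Definition E_fun n (c : F) (f : {poly_n.+1 F}) : {poly_n.+1 F} :=
  npolyp n.+1 (f \Po ('X + c%:P)).

Lemma polyn_E_fun n c (f : {poly_n.+1 F}) :
  E_fun c f = f \Po ('X + c%:P) :> {poly F}.
Proof. by rewrite npolypK // size_comp_poly2 ?size_XaddC // size_npoly. Qed.

Fact E_fun_is_linear n c : linear (@E_fun n c).
Proof.
move=> a f g; apply: val_inj => /=.
by rewrite !polyn_E_fun /= comp_polyD comp_polyZ.
Qed.

HB.instance Definition _ n c := GRing.isLinear.Build F {poly_n.+1 F}
  {poly_n.+1 F} _ (@E_fun n c) (@E_fun_is_linear n c).

Definition E n (c : F) : 'End({poly_n.+1 F}) := linfun (@E_fun n c).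

Lemma polyn_E n c (f : {poly_n.+1 F}) : E n c f = f \Po ('X + c%:P) :> {poly F}.
Proof. by rewrite lfunE polyn_E_fun. Qed.

Lemma polyn_U n p : (p <= n)%N ->
  U n (npolyp n.+1 'X^p) =
  n`!%:R^-1 *: ((1 - 'X) ^+ (n - p) * euler_poly p) :> {poly F}.
Proof.
move=> pn; have pn1 : (p < n.+1)%N by [].
rewrite lfunE /= /U_fun (bigD1 (Ordinal pn1)) //= big1 => [|i ip].
  by rewrite addr0 coef_npolyp pn1 coefXn eqxx scale1r npolypK ?size_U_image.
have /negPf ip' : (i : nat) != p by apply: contra ip => /eqP e; apply/eqP/val_inj.
by rewrite coef_npolyp ltn_ord coefXn ip' scale0r.
Qed.

(* Hence [(U n)^-1%VF] is the two-sided inverse of [U n]. *)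
Lemma lker_U n : lker (U n) == 0%VS.
Proof.
apply/lker0P => f g; rewrite !lfunE /= => Ufg.
apply/eqP; rewrite -subr_eq0; apply/eqP.
have {Ufg} U0 : U_fun (f - g) = 0 by rewrite linearB /= Ufg subrr.
move: (f - g) U0 => {f g} f U0.
suff f0 j : (f : {poly F}).[j%:R] = 0.
  apply/val_inj/eqP/negPn/negP => /= fn0.
  have rs_root : all (root f) [seq i%:R | i <- iota 0 n.+1].
    by apply/allP => _ /mapP[i _ ->]; apply/eqP/f0.
  have := max_poly_roots fn0 rs_root.
  rewrite map_inj_uniq ?iota_uniq; last exact: (mulrIn (oner_neq0 F)).
  by rewrite size_map size_iota ltnNge size_npoly => /(_ isT).
move: j; apply: (@iter_bdiff_inj F n.+1) => j.
have nf0 : n`!%:R != 0 :> F by rewrite pnatr_eq0 -lt0n fact_gt0.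
have := congr1 (fun q : {poly_n.+1 F} => take_poly j.+1 (n`!%:R *: (q : {poly F}))) U0.
rewrite /= scaler0 raddf0.
have -> : n`!%:R *: polyn (U_fun f) =
    \sum_(p < n.+1) f`_p *: ((1 - 'X) ^+ (n - p) * euler_poly p).
  rewrite raddf_sum scaler_sumr; apply: eq_bigr => p _.
  rewrite linearZ /= npolypK; last by apply: size_U_image; rewrite -ltnS.
  by rewrite !scalerA mulrAC divfK.
have E2 : \poly_(m < j.+1) (f : {poly F}).[m%:R] =
    \sum_(p < n.+1) f`_p *: \poly_(m < j.+1) (m ^ p)%:R :> {poly F}.
  apply/polyP => i; rewrite coef_sum coef_poly.
  under eq_bigr do rewrite coefZ coef_poly.
  case: ifP => _; last by rewrite big1 // => p _; rewrite mulr0.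
  rewrite (horner_coef_wide _ (size_npoly f)).
  by apply: eq_bigr => p _; rewrite natrX.
have -> : take_poly j.+1
    (\sum_(p < n.+1) f`_p *: ((1 - 'X) ^+ (n - p) * euler_poly p)) =
    take_poly j.+1 ((1 - 'X) ^+ n.+1 * \poly_(m < j.+1) (f : {poly F}).[m%:R]).
  rewrite E2 mulr_sumr !take_poly_sum; apply: eq_bigr => p _.
  rewrite -scalerAr !take_polyZ; congr (_ *: _).
  have -> : (1 - 'X : {poly F}) ^+ n.+1 = (1 - 'X) ^+ (n - p) * (1 - 'X) ^+ p.+1.
    by rewrite -exprD addnS subnK // -ltnS.
  rewrite -mulrA; apply/polyP => i; rewrite !coef_take_poly.
  case: ifP => // ij; rewrite !coefM; apply: eq_bigr => k _; congr (_ * _).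
  have ikj : (i - k < j.+1)%N by apply: leq_ltn_trans (leq_subr _ _) ij.
  have := congr1 (fun q : {poly F} => q`_(i - k)) (euler_polyP p j.+1).
  by rewrite !coef_take_poly ikj => <-.
rewrite take_poly_bdiff => /polyP/(_ j).
by rewrite coef_poly ltnSn coef0.
Qed.

(* [U_n E^(n beta) U_n^-1] *)
Definition G n (beta : F) : 'End({poly_n.+1 F}) :=
  (U n \o E n (n%:R * beta) \o (U n)^-1)%VF.

Definition gbin (c : F) (k : nat) : F := (\prod_(i < k) (c - i%:R)) / k`!%:R.

End Operators.

(* Main.v *)
Require Import Defs.
From mathcomp Require Import all_boot all_order all_algebra.
From mathcomp Require Import ring.
Import GRing.Theory Num.Theory.
Local Open Scope ring_scope.
Local Open Scope complex_scope.

(** By the definition of the Euler polynomials, [U n f] is [1/n!] times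
    [(1 - x)^(n+1) * \sum_(m >= 0) f(m) x^m]. Hence [U n] sends
    [n! * binom(x + n - p, n)] to [x^p], and the theorem reduces to
    [binom(t + a + n, n) =
       \sum_m binom(-a, m) binom(a + n, n - m) binom(t + n - m, n)]
    with [a = n beta - p]. Both sides are polynomials of degree at most [n] in
    [a], and at [a = -k] with [0 <= k <= n] only the term [m = k] survives. *)

Section GeneralizedBinomial.
Variable F : numFieldType.
Implicit Types (a c t : F) (q r : {poly F}).

Lemma poly_eq_natr n q r : (size q <= n)%N -> (size r <= n)%N ->
  (forall k, (k < n)%N -> q.[k%:R] = r.[k%:R]) -> q = r.
Proof.
move=> sq sr qr; apply/eqP; rewrite -subr_eq0; apply/eqP.
apply: (@roots_geq_poly_eq0 _ _ [seq k%:R | k <- iota 0 n]).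
- apply/allP => _ /mapP[k + ->]; rewrite mem_iota => kn.
  by rewrite rootE !hornerE qr // subrr.
- by rewrite map_inj_uniq ?iota_uniq //; apply: (mulrIn (oner_neq0 F)).
- rewrite size_map size_iota (leq_trans (size_polyD _ _)) // size_polyN.
  by rewrite geq_max sq.
Qed.

Lemma gbin_natr m k : gbin (m%:R : F) k = 'C(m, k)%:R.
Proof.
have k0 : k`!%:R != 0 :> F by rewrite pnatr_eq0 -lt0n fact_gt0.
apply: (mulIf k0); rewrite divfK // -natrM bin_ffact.
have [km|mk] := leqP k m; last first.
  rewrite ffact_small //; apply/eqP; rewrite prodf_seq_eq0; apply/hasP.
  by exists (Ordinal mk); rewrite ?mem_index_enum //= subrr.
rewrite ffact_prod natr_prod; apply: eq_bigr => i _.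
by rewrite natrB // (leq_trans (ltnW (ltn_ord i))).
Qed.

Definition gbin_poly k : {poly F} :=
  k`!%:R^-1 *: \prod_(i < k) ('X - i%:R%:P).

Lemma horner_gbin_poly k c : (gbin_poly k).[c] = gbin c k.
Proof.
rewrite /gbin_poly hornerZ horner_prod mulrC; congr (_ * _).
by apply: eq_bigr => i _; rewrite !hornerE.
Qed.

Lemma size_gbin_poly k : (size (gbin_poly k) <= k.+1)%N.
Proof.
rewrite (leq_trans (size_scale_leq _ _)) // size_prod_XsubC.
by rewrite [index_enum _]unlock -enumT size_enum_ord.
Qed.

Lemma gbin_vandermonde3 n a t :
  gbin (t + a + n%:R) n =
  \sum_(m < n.+1) gbin (- a) m * gbin (a + n%:R) (n - m)
                  * gbin (t + n%:R - m%:R) n.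
Proof.
(* [q] and [r] are the two sides as polynomials in [- a] rather than [a], so that the interpolation
   points are the naturals [0, ..., n]. *)
pose q := gbin_poly n \Po ((t + n%:R)%:P - 'X).
pose r := \sum_(m < n.+1) gbin (t + n%:R - m%:R) n *:
  (gbin_poly m * (gbin_poly (n - m) \Po (n%:R%:P - 'X))).
have sz c : size (c%:P - 'X : {poly F}) = 2%N.
  by rewrite -opprB size_polyN size_XsubC.
suff qr : q = r.
  have := congr1 (fun u : {poly F} => u.[- a]) qr.
  rewrite /q /r horner_comp horner_gbin_poly horner_sum hornerD hornerN.
  rewrite hornerC hornerX opprK addrAC.
  move=> ->; apply: eq_bigr => m _.
  rewrite hornerZ hornerM horner_comp !horner_gbin_poly hornerD hornerN hornerC.
  by rewrite hornerX opprK [n%:R + a]addrC mulrC.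
apply: (@poly_eq_natr n.+1).
- by rewrite size_comp_poly2 ?sz // size_gbin_poly.
- rewrite (leq_trans (size_sum _ _ _)) //; apply/bigmax_leqP => m _.
  rewrite (leq_trans (size_scale_leq _ _)) // (leq_trans (size_polyMleq _ _)) //.
  rewrite size_comp_poly2 ?sz // -ltnS -subn1 ltnS leq_subLR.
  rewrite (leq_trans (leq_add (size_gbin_poly _) (size_gbin_poly _))) //.
  by rewrite addSn addnS subnKC // -ltnS.
move=> k; rewrite ltnS => kn; rewrite /q /r horner_comp horner_sum.
have kn1 : (k < n.+1)%N by [].
have val_r (m : 'I_n.+1) : (gbin (t + n%:R - m%:R) n *:
    (gbin_poly m * (gbin_poly (n - m) \Po (n%:R%:P - 'X)))).[k%:R] =
    gbin (t + n%:R - m%:R) n * ('C(k, m) * 'C(n - k, n - m))%:R.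
  rewrite hornerZ hornerM horner_comp !horner_gbin_poly hornerD hornerN.
  by rewrite hornerC hornerX -natrB // !gbin_natr natrM.
rewrite (bigD1 (Ordinal kn1)) // big1 => [|m mk]; rewrite val_r /=.
  by rewrite addr0 !binn mulr1 horner_gbin_poly hornerD hornerN hornerC hornerX.
(* ['C(k, m)] kills the terms with [k < m], and ['C(n - k, n - m)] those with [m < k]. *)
have /orP[km|mk'] : (k < m)%N || (m < k)%N by rewrite -neq_ltn eq_sym.
  by rewrite bin_small // mul0n mulr0.
by rewrite ['C(n - k, _)]bin_small ?muln0 ?mulr0 // ltn_sub2l // (leq_trans mk').
Qed.

End GeneralizedBinomial.

Section UInverse.
Variable F : numFieldType.

Lemma coefM_take N (q r : {poly F}) j :
  (j < N)%N -> (q * take_poly N r)`_j = (q * r)`_j.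
Proof.
move=> jN; rewrite !coefM; apply: eq_bigr => i _.
by rewrite coef_take_poly (leq_ltn_trans (leq_subr _ _) jN).
Qed.

(** By linearity it is enough to treat [x^p], where [(1 - x)^(n-p) A_p = (1 - x)^(n+1) \sum_m m^p
    x^m]. Cutting the series at degree [n] leaves the coefficients of index [j <= n] unchanged. *)
Lemma coef_U n (f : {poly_n.+1 F}) j : (j < n.+1)%N ->
  (U F n f : {poly F})`_j =
  n`!%:R^-1 * ((1 - 'X) ^+ n.+1 * \poly_(m < n.+1) (f : {poly F}).[m%:R])`_j.
Proof.
move=> jn.
have -> : \poly_(m < n.+1) (f : {poly F}).[m%:R] =
    \sum_(p < n.+1) f`_p *: \poly_(m < n.+1) (m ^ p)%:R :> {poly F}.
  apply/polyP => i; rewrite coef_sum coef_poly.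
  under eq_bigr do rewrite coefZ coef_poly.
  case: ifP => _; last by rewrite big1 // => p _; rewrite mulr0.
  rewrite (horner_coef_wide _ (size_npoly f)).
  by apply: eq_bigr => p _; rewrite natrX.
rewrite lfunE /= /U_fun raddf_sum mulr_sumr !coef_sum mulr_sumr.
apply: eq_bigr => p _; have pn : (p <= n)%N by rewrite -ltnS.
rewrite /= npolypK ?size_U_image // -scalerAr !coefZ mulrCA.
congr (_ * (_ * _)).
rewrite -(coefM_take _ _ _ _ jn) -euler_polyP coefM_take // mulrA -exprD.
by rewrite addnS subnK.
Qed.

(** This is [x^p / (1 - x)^(s+1) = \sum_(m >= p) binom(m - p + s, s) x^m]: by Pascal's rule each
    difference lowers [s] by one, down to the unit step at [p], whose difference is the indicator of
    [p]. *)
Lemma iter_bdiff_bin s p (f : nat -> F) :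
  (forall m, f m = if (m < p)%N then 0 else 'C(m - p + s, s)%:R) ->
  forall j, iter s.+1 (@bdiff F) f j = (j == p)%:R.
Proof.
elim: s f => [|s IHs] f fE j.
  case: j => [|j] /=; rewrite !fE ?bin0.
    by case: p {fE} => [|p].
  by case: (ltngtP j.+1 p) => _; rewrite ?subrr ?subr0.
rewrite iterSr; apply: IHs => -[|m] /=; rewrite !fE.
  by case: p {fE} => //; rewrite !binn.
case: (ltngtP m.+1 p) => [mp|mp|mp].
- by rewrite subr0.
- by rewrite subSn // addSn binS natrD addrAC subrr add0r addSnnS.
- by rewrite -mp subnn !binn subr0.
Qed.

(* [x^p] under [U n ^-1]: the paper's [(x)_p [x+1]_(n-p)] is
   [n! * binom(x + n - p, n)]. *)
Definition Uinv_mono n p : {poly_n.+1 F} :=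
  npolyp n.+1 (n`!%:R *: (gbin_poly F n \Po ('X + (n%:R - p%:R)%:P))).

Lemma horner_Uinv_mono n p t :
  (Uinv_mono n p : {poly F}).[t] = n`!%:R * gbin (t + n%:R - p%:R) n.
Proof.
rewrite /Uinv_mono npolypK.
  by rewrite hornerZ horner_comp horner_gbin_poly hornerD hornerX hornerC addrA.
rewrite (leq_trans (size_scale_leq _ _)) // size_comp_poly2 ?size_XaddC //.
exact: size_gbin_poly.
Qed.

Lemma U_Uinv_mono n p : (p <= n)%N ->
  U F n (Uinv_mono n p) = npolyp n.+1 'X^p.
Proof.
move=> pn; apply/val_inj/polyP => j /=; rewrite npolypK ?size_polyXn //.
have [nj|jn] := leqP n.+1 j.
  rewrite nth_default ?(leq_trans (size_npoly _)) // coefXn.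
  by rewrite gtn_eqF // (leq_trans _ nj).
have n0 : n`!%:R != 0 :> F by rewrite pnatr_eq0 -lt0n fact_gt0.
rewrite coef_U // coefXn.
(* The case [m < p] is separate because truncated subtraction would give ['C(n, n) = 1] there, while
   the true value ['C(m + n - p, n)] is 0, as [m + n - p < n]. *)
pose w m : F := if (m < p)%N then 0 else 'C(m - p + n, n)%:R.
have -> : \poly_(m < n.+1) (Uinv_mono n p : {poly F}).[m%:R] =
    n`!%:R *: \poly_(m < n.+1) w m.
  apply/polyP => m; rewrite coefZ !coef_poly.
  case: ifP => _; last by rewrite mulr0.
  rewrite horner_Uinv_mono -natrD -natrB ?(leq_trans pn) ?leq_addl //.
  rewrite gbin_natr; congr (_ * _); rewrite /w; case: ltnP => mp; last by rewrite addnBAC.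
  by rewrite bin_small // ltn_subLR ?(leq_trans pn) ?leq_addl // ltn_add2r.
rewrite -scalerAr coefZ mulKf //.
have /polyP/(_ j) := take_poly_bdiff n.+1 n.+1 w.
by rewrite coef_take_poly coef_poly jn => ->; apply: iter_bdiff_bin.
Qed.

Lemma invU_mono n p : (p <= n)%N ->
  (U F n)^-1%VF (npolyp n.+1 'X^p) = Uinv_mono n p.
Proof. by move=> pn; rewrite -U_Uinv_mono // lker0_lfunK // lker_U. Qed.

(** At each natural point [k] this is [gbin_vandermonde3] with [a = c - p] and [t = k], multiplied
    by [n!]; the points [0, ..., n] determine both sides. *)
Lemma E_Uinv_mono n p c : E n c (Uinv_mono n p) =
  \sum_(m < n.+1) (gbin (- c + p%:R) m * gbin (c + n%:R - p%:R) (n - m))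
                  *: Uinv_mono n m.
Proof.
apply: val_inj => /=; rewrite polyn_E raddf_sum /=.
apply: (@poly_eq_natr _ n.+1).
- by rewrite size_comp_poly2 ?size_XaddC ?size_npoly.
- rewrite (leq_trans (size_sum _ _ _)) //; apply/bigmax_leqP => m _.
  by rewrite (leq_trans (size_scale_leq _ _)) ?size_npoly.
move=> k _; rewrite horner_comp horner_sum horner_Uinv_mono hornerD hornerX hornerC.
have -> : k%:R + c + n%:R - p%:R = k%:R + (c - p%:R) + n%:R by ring.
rewrite gbin_vandermonde3 mulr_sumr; apply: eq_bigr => m _.
rewrite hornerZ horner_Uinv_mono mulrCA opprB [p%:R - c]addrC.
by rewrite [c - p%:R + _]addrAC.
Qed.

End UInverse.

Theorem theorem17 (R : realType) (n : nat) (beta : R[i]) (p : nat)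
  (le_pn : (p <= n)%N) :
  (G n beta (npolyp n.+1 'X^p) : {poly R[i]}) =
  \sum_(0 <= m < n.+1)
     (gbin (- (n%:R * beta) + p%:R) m
        * gbin (n%:R * beta + n%:R - p%:R) (n - m)) *: 'X^m.
Proof.
(* With [c = n beta], the shift expands [Uinv_mono n p] in the family [Uinv_mono n m], and [U n]
   turns each member back into [x^m]. *)
rewrite /G !comp_lfunE invU_mono // E_Uinv_mono linear_sum raddf_sum big_mkord.
apply: eq_bigr => m _; have mn : (m <= n)%N by rewrite -ltnS.
by rewrite linearZ /= U_Uinv_mono // npolypK // size_polyXn.
Qed.
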